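(* There exists a function $f_0$ from the positive integers to the positive integers such that the following holds. Let $G$ be a non-abelian finite group, let $m=\operatorname{mci}(G)$, and let $\pi^*$ be the set of all primes $p$ dividing $|G|$ for which a Sylow $p$-subgroup $P$ of $G$ satisfies $|P|=p$ and $C_G(P)=PZ(G)$. Then $$|G|\le\Big(\prod_{p\in\pi^*}p\Big)\cdot f_0(m).$$
   Context: For a non-abelian finite group $G$, the maximum centralizer index of $G$ is $$\operatorname{mci}(G)=\max\{\,|C_G(g):\langle g\rangle| \;:\; g\in G\smallsetminus Z(G)\,\}.$$ Here $C_G(\cdot)$ denotes the centralizer in $G$ and $Z(G)$ the centre of $G$. An empty product equals $1$. *)

(* Defs.v *)
From mathcomp Require Import all_boot all_fingroup all_solvable.

Set Implicit Arguments.
Unset Strict Implicit.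
Unset Printing Implicit Defensive.

Local Open Scope group_scope.

(* The max over the empty range is 0, so mci G = 0 when G is abelian; for
   non-abelian G it is the maximum of a nonempty set of positive integers. *)
Definition mci (gT : finGroupType) (G : {group gT}) : nat :=
  \max_(g in G :\: 'Z(G)) #|'C_G[g] : <[g]>|.

(* The condition on P is invariant under conjugation in G, so it does not
   matter which Sylow p-subgroup is used. *)
Definition pi_star (gT : finGroupType) (G : {group gT}) : nat_pred :=
  [pred p | (p \in \pi(G)) &&
     [exists P : {group gT},
        [&& P \in 'Syl_p(G), #|P| == p & 'C_G(P) == P * 'Z(G)]]].

(* Main.v *)
(* Let m bound |C_G(g) : <g>| for all noncentral g; subgroups inherit this bound.
   A nonabelian p-group P has p <= 2m.  Pick g noncentral in the second centre
   of P with g^p central, and x not commuting with g.  Since g^p lies in C_P(x),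
   some power g^a with a <= pm lies in <x>, and a suitable twist x^-n g or
   g^-n x is noncentral of order at most p^2 m.  This bounds |Z(P)|, then
   |C_P(g)|, and then |P|, because |P : C_P(g)| <= |Z(P)|.
   For general G, a noncentral q-element shows that the q'-part of Z(G) is at
   most m.  Either some Sylow subgroup is nonabelian, and then contains a
   noncentral element of bounded order, or two different primes have
   noncentral elements; in both cases |Z(G)| is bounded by some B(m), and so is
   each Sylow p-subgroup in terms of m and p.  If p > B(m), then a Sylow
   p-subgroup P has order p, and a noncentral p'-element y of C_G(P) would have
   order at most m, so that p <= |C_G(y)| <= m^2 < p.  Hence p is in pi^*, so
   only the primes p <= B(m) can contribute to the remaining factor. *)

Require Import Defs.
From mathcomp Require Import all_boot all_fingroup all_solvable.
From mathcomp Require Import zify.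

Set Implicit Arguments.
Unset Strict Implicit.
Unset Printing Implicit Defensive.

Local Open Scope group_scope.

(** * Noncentral elements under a bound on centralizer indices *)

Definition cent_index_le (gT : finGroupType) (G : {group gT}) (m : nat) :=
  forall g, g \in G :\: 'Z(G) -> #|'C_G[g]| <= (m * #[g])%N.

Lemma cycle_sub_cent1 (gT : finGroupType) (G : {group gT}) g :
  g \in G -> <[g]> \subset 'C_G[g].
Proof. by move=> gG; rewrite cycle_subG inE gG cent1id. Qed.

Lemma mci_cent_index_le (gT : finGroupType) (G : {group gT}) :
  cent_index_le G (mci G).
Proof.
move=> g gGZ; have /setDP[gG _] := gGZ.
rewrite -(Lagrange (cycle_sub_cent1 gG)) mulnC leq_mul2r.
by rewrite /mci (leq_bigmax_cond (F := fun g => #|'C_G[g] : <[g]>|)) ?orbT.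
Qed.

Lemma noncenterI (gT : finGroupType) (G : {group gT}) g x :
  g \in G -> x \in G -> [~ g, x] != 1 -> g \in G :\: 'Z(G).
Proof.
move=> gG xG ncgx; rewrite inE gG andbT; apply: contra ncgx => /centerP[_ cGg].
by apply/commgP; apply: cGg.
Qed.

Lemma noncenter_commg (gT : finGroupType) (G : {group gT}) g :
  g \in G :\: 'Z(G) -> exists2 x, x \in G & [~ g, x] != 1.
Proof.
case/setDP=> gG; rewrite inE gG -sub_cent1 => /subsetPn[x xG cx].
by exists x => //; apply: contra cx => /commgP cgx; apply/cent1P.
Qed.

Lemma noncenter_ex (gT : finGroupType) (G : {group gT}) :
  ~~ abelian G -> exists g, g \in G :\: 'Z(G).
Proof.
case/subsetPn=> g gG ncg; exists g.
by rewrite inE gG andbT; apply: contra ncg => /setIP[].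
Qed.

(** An element noncentral in [H] fails to commute with something in [H], so it is noncentral in [G];
    its centralizer in [H] is no larger. *)
Lemma cent_index_leS (gT : finGroupType) (G H : {group gT}) m :
  H \subset G -> cent_index_le G m -> cent_index_le H m.
Proof.
move=> sHG leG g gHZ; have /setDP[gH _] := gHZ.
have [x xH ncgx] := noncenter_commg gHZ.
have gGZ := noncenterI (subsetP sHG _ gH) (subsetP sHG _ xH) ncgx.
exact: leq_trans (subset_leq_card (setSI _ sHG)) (leG g gGZ).
Qed.

Lemma cent_index_gt0 (gT : finGroupType) (G : {group gT}) m :
  ~~ abelian G -> cent_index_le G m -> 0 < m.
Proof.
move=> /noncenter_ex[g gGZ] /(_ g gGZ); case: m => //.
by rewrite mul0n leqn0 -[_ == _]negbK -lt0n cardG_gt0.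
Qed.

Lemma noncenter_root (gT : finGroupType) (G : {group gT}) (p : nat) g :
    p.-elt g -> g \in G :\: 'Z(G) ->
  exists i, g ^+ i \in G :\: 'Z(G) /\ g ^+ i ^+ p \in 'Z(G).
Proof.
move=> pg /setDP[gG gZ]; have [k og] := p_natP pg.
have exZ : exists n, g ^+ (p ^ n) \in 'Z(G) by exists k; rewrite -og expg_order.
(* The least exponent is positive because [g] is noncentral; the exponent just below it gives the
   required power. *)
case: (ex_minnP exZ) => [[|n]]; first by rewrite expn0 expg1 (negPf gZ).
move=> gnZ min_n; exists (p ^ n)%N.
rewrite -expgM mulnC -expnS gnZ in_setD (groupX _ gG) andbT.
by split=> //; apply/negP=> /min_n; rewrite ltnn.
Qed.

(** Some power [h] of [g] is noncentral with [h ^+ p] central. Its centralizer contains that of [g],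
    and its order divides [p * #|'Z(G)|]. *)
Lemma card_cent1_le (gT : finGroupType) (G : {group gT}) m (p : nat) g :
    cent_index_le G m -> prime p -> p.-elt g -> g \in G :\: 'Z(G) ->
  #|'C_G[g]| <= (m * (p * #|'Z(G)|))%N.
Proof.
move=> leG pr_p pg gGZ; have [i [hGZ hpZ]] := noncenter_root pg gGZ.
have sC : 'C_G[g] \subset 'C_G[g ^+ i].
  apply: setIS; apply/subsetP=> x /cent1P cgx; apply/cent1P.
  exact: commuteX.
apply: leq_trans (subset_leq_card sC) (leq_trans (leG _ hGZ) _).
rewrite leq_mul2l; apply/orP; right.
apply: dvdn_leq _; first by rewrite muln_gt0 prime_gt0 ?cardG_gt0.
by rewrite order_dvdn expgM -order_dvdn; apply: order_dvdG.
Qed.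

(** * Nonabelian p-groups *)

Lemma class2_twist_expg (gT : finGroupType) (x y : gT) p n a :
    commute x [~ x, y] -> commute y [~ x, y] -> [~ x, y] ^+ p = 1 ->
    x ^+ a = y ^+ (n * a) ->
  (y ^- n * x) ^+ (a * p) = 1 /\ [~ y ^- n * x, y] = [~ x, y].
Proof.
move=> cx cy cp eqxy; set c := [~ x, y] in cx cy cp.
have cyn : [~ x, y ^+ n] = c ^+ n by apply: commgX.
have cynV : [~ x, y ^- n] = c ^- n.
  by rewrite commgV cyn //; apply: commuteX2.
split.
  have cX : commute x (c ^- n) by apply: commuteV (commuteX _ _).
  have cY : commute (y ^- n) (c ^- n).
    by apply/commuteV/commute_sym/commuteV; apply: commuteX2; apply: commute_sym.
  (* The [a]-th power collapses to a power of the commutator [c], which [p] then kills. *)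
  rewrite expgM expMg_Rmul ?cynV // expgVn -expgM eqxy mulVg mul1g.
  by rewrite -expgM mulnC expgM expgVn -expgM mulnC expgM cp expg1n invg1 expg1n.
rewrite commMgJ (_ : [~ y ^- n, y] = 1) ?conj1g ?mul1g //.
by apply/eqP/commgP/commute_sym; apply: commuteV (commuteX _ _).
Qed.

(** For odd [p], the noncyclic [P] contains an elementary abelian [E] of rank 2, so some noncentral
    [x] has a noncyclic centralizer. The factor 2 in the bound serves only [p = 2]. *)
Lemma pgroup_prime_le (gT : finGroupType) (P : {group gT}) (p : nat) m :
  p.-group P -> ~~ abelian P -> cent_index_le P m -> p <= m.*2.
Proof.
move=> pP nabP leP; have m_gt0 := cent_index_gt0 nabP leP.
have [g gPZ] := noncenter_ex nabP; have /setDP[gP gZ] := gPZ.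
have ntP : P :!=: 1 by apply: contra nabP => /eqP->; apply: abelian1.
have [pr_p _ _] := pgroup_pdiv pP ntP.
have [-> | odd_p] := even_prime pr_p; first by rewrite -muln2 -{1}[2]mul1n leq_pmul2r.
suff le_pm : p <= m by rewrite (leq_trans le_pm) // -addnn leq_addr.
have oddP : odd #|P| by have [k ->] := p_natP pP; rewrite oddX odd_p orbT.
have: ~~ cyclic P by apply: contra nabP => /cyclic_abelian.
rewrite (odd_pgroup_rank1_cyclic pP oddP) -ltnNge => /p_rank_geP[E].
case/pnElemP=> sEP abE logE.
have ncycE : ~~ cyclic E by rewrite (abelem_cyclic abE) logE.
(* C_P(x) is not cyclic, so the p-power |C_P(x) : <x>| is at least p. *)
have [x xPZ sEC] : exists2 x, x \in P :\: 'Z(P) & E \subset 'C_P[x].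
  (* If [E] is central, any noncentral element will do; otherwise one is picked in [E]. *)
  have [sEZ | /subsetPn[x xE xZ]] := boolP (E \subset 'Z(P)).
    exists g; rewrite // subsetI sEP sub_cent1 (subsetP _ g gP) // centsC.
    by rewrite (subset_trans sEZ) ?subsetIr.
  exists x; first by rewrite inE xZ (subsetP sEP).
  by rewrite subsetI sEP sub_cent1 (subsetP (abelem_abelian abE)).
have sxC : <[x]> \subset 'C_P[x] by apply: cycle_sub_cent1; case/setDP: xPZ.
have /p_natP[[|k] ixC] : p.-nat #|'C_P[x] : <[x]>|.
- by apply: pnat_dvd (dvdn_indexg _ _) (pgroupS _ pP); rewrite subsetIl.
- have /eqP := ixC; rewrite expn0 indexg_eq1 => sCx.
  by case/negP: ncycE; apply: cyclicS (subset_trans sEC sCx) (cycle_cyclic x).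
have := leP x xPZ; rewrite -(Lagrange sxC) mulnC leq_pmul2r ?order_gt0 // ixC.
by apply: leq_trans; rewrite expnS leq_pmulr // expn_gt0 prime_gt0.
Qed.

Lemma second_center_ex (gT : finGroupType) (G : {group gT}) :
    nilpotent G -> ~~ abelian G ->
  exists2 g, g \in G :\: 'Z(G) & forall x, x \in G -> [~ g, x] \in 'Z(G).
Proof.
move=> nilG nabG; have nZG := normal_norm (center_normal G).
have: 'Z(G / 'Z(G)) != 1.
  rewrite center_nil_eq1 ?quotient_nil // -subG1 quotient_sub1 //.
  by apply: contra nabG => sGZ; apply: abelianS sGZ (center_abelian G).
case/trivgPn=> gb /setIP[/morphimP[g nZg gG defg] cgb] ntgb; exists g.
  rewrite inE gG andbT; apply: contra ntgb => gZ.
  by rewrite defg; apply/eqP/coset_id.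
move=> x xG; have nZx := subsetP nZG x xG.
rewrite coset_idr ?groupR // morphR //; apply/eqP/commgP; rewrite -defg.
by apply: (centP cgb); apply: mem_quotient.
Qed.

(** The conjugacy class of [g] lies in the coset [g *: 'Z(G)]. *)
Lemma second_center_index (gT : finGroupType) (G : {group gT}) g :
    g \in G -> (forall x, x \in G -> [~ g, x] \in 'Z(G)) ->
  #|G| <= (#|'Z(G)| * #|'C_G[g]|)%N.
Proof.
move=> gG gZ2; rewrite -(Lagrange (subsetIl G 'C[g])) mulnC leq_pmul2r //.
rewrite index_cent1 -(card_lcoset 'Z(G) g); apply: subset_leq_card.
apply/subsetP=> _ /imsetP[x xG ->]; rewrite conjg_mulR mem_lcoset mulKg.
exact: gZ2.
Qed.

(** The index is that of [H :&: <[w]>], which is normal in the abelian [<[w]>]; the order of the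
    quotient kills the image of [w]. *)
Lemma cycle_index_exp (gT : finGroupType) (H : {group gT}) w :
  w ^+ #|<[w]> : H| \in H.
Proof.
have sKw : H :&: <[w]> \subset <[w]> by apply: subsetIr.
have nKw : <[w]> \subset 'N(H :&: <[w]>).
  exact: cents_norm (centSS (subxx _) sKw (cycle_abelian w)).
have nKw1 : w \in 'N(H :&: <[w]>) := subsetP nKw _ (cycle_id w).
suff: w ^+ #|<[w]> : H| \in H :&: <[w]> by case/setIP.
rewrite coset_idr ?groupX // morphX // -indexgI setIC -card_quotient //.
by rewrite expg_cardG ?mem_quotient ?cycle_id.
Qed.

(** Centrality of [w] makes [<[w]> <*> <[y]>] a product inside ['C_G[y]], of order [#[y]] times the
    index. *)
Lemma cent_cycle_index (gT : finGroupType) (G : {group gT}) m w y :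
    cent_index_le G m -> w \in 'Z(G) -> y \in G :\: 'Z(G) ->
  #|<[w]> : <[y]>| <= m.
Proof.
move=> leG wZ yGZ; have /setDP[yG _] := yGZ; have /setIP[wG cGw] := wZ.
have cyw : <[w]> \subset 'C(<[y]>).
  by rewrite cent_cycle cycle_subG; apply/cent1P; exact: (centP cGw y yG).
have sC : <[w]> <*> <[y]> \subset 'C_G[y].
  rewrite join_subG (cycle_sub_cent1 yG) subsetI andbT cycle_subG wG.
  by move: cyw; rewrite cent_cycle.
have := leq_trans (subset_leq_card sC) (leG y yGZ); rewrite cent_joinEl // => le_wy.
rewrite -(leq_pmul2r (order_gt0 y)) -divgI; apply: leq_trans le_wy.
rewrite -(leq_pmul2r (cardG_gt0 (<[w]> :&: <[y]>))) -mul_cardG mulnAC.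
by rewrite divnK ?cardSg ?subsetIl.
Qed.

Lemma pgroup_small_noncenter (gT : finGroupType) (P : {group gT}) (p : nat) m :
    p.-group P -> ~~ abelian P -> cent_index_le P m ->
  exists2 z, z \in P :\: 'Z(P) & #[z] <= (p * (p * m))%N.
Proof.
move=> pP nabP leP.
have ntP : P :!=: 1 by apply: contra nabP => /eqP->; apply: abelian1.
have [pr_p _ _] := pgroup_pdiv pP ntP.
have [g0 g0PZ g0Z2] := second_center_ex (pgroup_nil pP) nabP.
have /setDP[g0P _] := g0PZ.
have [i [gPZ gpZ]] := noncenter_root (mem_p_elt pP g0P) g0PZ.
have cZ y z : y \in P -> z \in 'Z(P) -> commute y z.
  by move=> yP /setIP[_ /centP cz]; apply: commute_sym (cz y yP).
have gZ2 y : y \in P -> [~ g0 ^+ i, y] \in 'Z(P).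
  by move=> yP; rewrite commXg ?groupX ?g0Z2 //; apply: cZ; rewrite ?g0Z2.
move: (g0 ^+ i) gPZ gpZ gZ2 => {i g0 g0PZ g0Z2 g0P} g gPZ gpZ gZ2.
have /setDP[gP _] := gPZ.
have [x xP ncgx] := noncenter_commg gPZ.
have ncxg : [~ x, g] != 1 by rewrite -invg_comm invg_eq1.
have xPZ := noncenterI xP gP ncxg.
have gxZ := gZ2 x xP; have xgZ : [~ x, g] \in 'Z(P) by rewrite -invg_comm groupV.
have gxp : [~ g, x] ^+ p = 1.
  rewrite -commXg; last exact: cZ.
  exact/eqP/commgP/commute_sym/cZ.
have xgp : [~ x, g] ^+ p = 1 by rewrite -invg_comm expgVn gxp invg1.
(* Stated for arbitrary [z] and [y], since [g] and [x] may have to exchange roles. *)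
have small z n a y : y \in P -> z \in P -> [~ z, y] != 1 -> [~ z, y] \in 'Z(P) ->
    [~ z, y] ^+ p = 1 -> 0 < a -> a <= (p * m)%N -> z ^+ a = y ^+ (n * a) ->
  exists2 z, z \in P :\: 'Z(P) & #[z] <= (p * (p * m))%N.
  move=> yP zP nczy zyZ zyp a_gt0 le_a eqzy.
  have [zap zyE] := class2_twist_expg (cZ _ _ zP zyZ) (cZ _ _ yP zyZ) zyp eqzy.
  exists (y ^- n * z).
    by rewrite (@noncenterI _ _ _ y) ?groupM ?groupV ?groupX ?zyE.
  have le_ap : (a * p <= p * (p * m))%N by rewrite mulnC leq_mul2l le_a orbT.
  apply: leq_trans le_ap.
  by rewrite dvdn_leq ?muln_gt0 ?a_gt0 ?prime_gt0 // order_dvdn zap.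
have le_j := cent_cycle_index leP gpZ xPZ.
have /p_natP[k ej] : p.-nat #|<[g ^+ p]> : <[x]>|.
  apply: pnat_dvd (dvdn_indexg _ _) (pgroupS _ pP).
  by rewrite cycle_subG groupX.
have := cycle_index_exp <[x]> (g ^+ p); rewrite -expgM.
rewrite ej -expnS in le_j * => /cycleP[u gx].
have le_a : (p ^ k.+1 <= p * m)%N by rewrite expnS leq_mul2l le_j orbT.
(* Here [g ^+ (p ^ k.+1) = x ^+ u]. If [p ^ k.+1] divides [u], then [g] is twisted by a power of
   [x]; otherwise [u] has a smaller p-part and [x] is twisted by a power of [g]. *)
have [/dvdnP[n eu] | ndvd] := boolP (p ^ k.+1 %| u).
  by rewrite eu in gx; apply: small gx => //; rewrite expn_gt0 prime_gt0.
have u_gt0 : 0 < u by case: u ndvd {gx} => //; rewrite dvdn0.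
have [u' cop_u' eu] := pfactor_coprime pr_p u_gt0; set v := logn p u in eu.
have lt_vk : v < k.+1 by rewrite ltnNge -pfactor_dvdn.
have: x ^+ (p ^ v) \in <[g ^+ (p ^ k.+1)]>.
  rewrite gx eu mulnC expgM.
  (* As [u'] is prime to [p], the p-element [x ^+ (p ^ v)] generates the same cyclic group as its
     [u']-th power. *)
  have /eqP <- : generator <[x ^+ (p ^ v)]> (x ^+ (p ^ v) ^+ u').
    have [r or] := p_natP (mem_p_elt pP (groupX (p ^ v) xP)).
    by rewrite generator_coprime or coprimeXl.
  by rewrite cycle_id.
case/cycleP=> t; rewrite -expgM -(subnK (ltnW lt_vk)) expnD.
rewrite -mulnA [(p ^ v * t)%N]mulnC mulnA => xg.
apply: small xg => //; first by rewrite expn_gt0 prime_gt0.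
by apply: leq_trans le_a; rewrite leq_pexp2l ?prime_gt0 // ltnW.
Qed.

(** Inserting [p <= 2 * m], the centre has order at most [4 * m ^ 4] and the centralizer of a
    noncentral [g] in the second centre at most [8 * m ^ 6]; the product of the two bounds
    [#|P|]. *)
Lemma pgroup_card_le (gT : finGroupType) (P : {group gT}) (p : nat) m :
    p.-group P -> ~~ abelian P -> cent_index_le P m ->
  #|P| <= 32 * m ^ 10.
Proof.
move=> pP nabP leP; have le_p := pgroup_prime_le pP nabP leP.
have ntP : P :!=: 1 by apply: contra nabP => /eqP->; apply: abelian1.
have [pr_p _ _] := pgroup_pdiv pP ntP.
have le_p2 k : p * k <= 2 * m * k by rewrite mul2n leq_mul2r le_p orbT.
have leZ : #|'Z(P)| <= 4 * m ^ 4.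
  have [z zPZ le_z] := pgroup_small_noncenter pP nabP leP.
  have /setDP[zP _] := zPZ.
  have sZC : 'Z(P) \subset 'C_P[z].
    by rewrite subsetI center_sub sub_cent1 (subsetP _ z zP) // centsC subsetIr.
  apply: leq_trans (subset_leq_card sZC) (leq_trans (leP z zPZ) _).
  rewrite (_ : 4 * m ^ 4 = m * (2 * m * (2 * m * m)))%N; last by lia.
  rewrite leq_mul2l (leq_trans le_z) ?orbT // (leq_trans (le_p2 _)) // leq_mul2l.
  by rewrite le_p2 orbT.
have [g gPZ gZ2] := second_center_ex (pgroup_nil pP) nabP.
have /setDP[gP _] := gPZ.
apply: leq_trans (second_center_index gP gZ2) _.
have leC := card_cent1_le leP pr_p (mem_p_elt pP gP) gPZ.
apply: (@leq_trans (4 * m ^ 4 * (m * (2 * m * (4 * m ^ 4))))); last by lia.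
apply: (leq_mul leZ (leq_trans leC _)).
by rewrite leq_mul2l (leq_mul _ leZ) ?orbT // mul2n.
Qed.

(** * The order of the centre *)

Lemma center_sub_cent1 (gT : finGroupType) (G : {group gT}) g :
  g \in G -> 'Z(G) \subset 'C_G[g].
Proof.
by move=> gG; rewrite subsetI center_sub sub_cent1 (subsetP _ g gG) // centsC subsetIr.
Qed.

(** This part and [#[g]] are coprime divisors of [#|'C_G[g]|], which is at most [m * #[g]]. *)
Lemma center_p'part_le (gT : finGroupType) (G : {group gT}) m (p : nat) g :
    cent_index_le G m -> p.-elt g -> g \in G :\: 'Z(G) ->
  #|'Z(G)|`_p^' <= m.
Proof.
move=> leG pg gGZ; have /setDP[gG _] := gGZ.
rewrite -(leq_pmul2r (order_gt0 g)); apply: leq_trans (leG g gGZ).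
rewrite dvdn_leq // Gauss_dvd; last first.
  by rewrite coprime_sym (pnat_coprime pg) // part_pnat.
rewrite (dvdn_trans (dvdn_part _ _)) ?cardSg ?center_sub_cent1 //.
exact: cycle_sub_cent1.
Qed.

(** The Sylow subgroups generate [G], so they cannot all be central. *)
Lemma noncentral_Sylow (gT : finGroupType) (G : {group gT}) :
  ~~ abelian G -> exists2 P : {group gT}, Sylow G P & ~~ (P \subset 'Z(G)).
Proof.
move=> nabG.
have [/exists_inP[P] | no_P] :=
  boolP [exists (P : {group gT} | Sylow G P), ~~ (P \subset 'Z(G))].
  by exists P.
case/negP: nabG; apply: abelianS (center_abelian G).
rewrite -{1}(Sylow_gen G) gen_subG; apply/bigcupsP=> P sylP.
by apply: contraR no_P => nPZ; apply/exists_inP; exists P.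
Qed.

(** Since ['C_G(P)] is proper, its order misses the full [r]-part of [#|G|] for some [r]. This
    supplies noncentral elements for a second prime. *)
Lemma noncommuting_Sylow (gT : finGroupType) (G P : {group gT}) :
    P \subset G -> ~~ (P \subset 'Z(G)) ->
  exists2 r, r \in \pi(G) & forall R : {group gT}, r.-Sylow(G) R -> ~~ (R \subset 'C(P)).
Proof.
move=> sPG nPZ.
have [r rG ndvd]: exists2 r, r \in primes #|G| & ~~ (#|G|`_r %| #|'C_G(P)|).
  apply/hasP; apply: contraR nPZ => /hasPn dvdGC.
  have /(dvdn_leq (cardG_gt0 _)) leGC : #|G| %| #|'C_G(P)|.
    by apply/dvdn_partP=> // r rG; have := dvdGC r rG; rewrite negbK.
  have /eqP eqCG : 'C_G(P) == G by rewrite eqEcard subsetIl.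
  by rewrite subsetI sPG centsC -eqCG subsetIr.
exists r => // R sylR; apply: contra ndvd => cRP.
by rewrite -(card_Hall sylR) cardSg // subsetI cRP (pHall_sub sylR).
Qed.

Lemma center_card_le (gT : finGroupType) (G : {group gT}) m :
  ~~ abelian G -> cent_index_le G m -> #|'Z(G)| <= 32 * m ^ 11.
Proof.
move=> nabG leG; have m_gt0 := cent_index_gt0 nabG leG.
have [P /SylowP[p pr_p sylP] nPZ] := noncentral_Sylow nabG.
have sPG := pHall_sub sylP; have pP := pHall_pgroup sylP.
have [abP | nabP] := boolP (abelian P); last first.
  have [g /setDP[gP gZ]] := noncenter_ex nabP.
  have leP := pgroup_card_le pP nabP (cent_index_leS sPG leG).
  have gGZ : g \in G :\: 'Z(G).
    rewrite inE (subsetP sPG) // andbT; apply: contra gZ => /setIP[_ cGg].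
    by rewrite inE gP (subsetP (centS sPG)).
  have gG := subsetP sPG g gP.
  apply: leq_trans (subset_leq_card (center_sub_cent1 gG)) _.
  apply: leq_trans (leG g gGZ) _; rewrite expnS mulnCA leq_mul2l.
  by rewrite (leq_trans _ leP) ?orbT // subset_leq_card ?cycle_subG.
have [g gP gZ] := subsetPn nPZ.
have gGZ : g \in G :\: 'Z(G) by rewrite inE gZ (subsetP sPG).
have [r rG nRP] := noncommuting_Sylow sPG nPZ.
have [R sylR] := Sylow_exists r G.
have sRG := pHall_sub sylR.
have [x xR ncx] := subsetPn (nRP R sylR).
have xGZ : x \in G :\: 'Z(G).
  rewrite inE (subsetP sRG) // andbT; apply: contra ncx => /setIP[_ cGx].
  by rewrite (subsetP (centS sPG)).
(* The abelian [P] centralizes itself, whereas no Sylow [r]-subgroup centralizes [P]. *)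
have neq_pr : p != r.
  by apply: contraL abP => /eqP eq_pr; rewrite nRP // -eq_pr.
have leZp := center_p'part_le leG (mem_p_elt pP gP) gGZ.
have leZr := center_p'part_le leG (mem_p_elt (pHall_pgroup sylR) xR) xGZ.
(* The p-part of [#|'Z(G)|] divides its r'-part, so both factors are at most [m]. *)
rewrite -(partnC p (cardG_gt0 'Z(G))); apply: (@leq_trans (m * m)); last first.
  by rewrite mulnn (leq_trans (leq_pexp2l m_gt0 (isT : 2 <= 11))) ?leq_pmull.
apply: leq_mul leZp; apply: leq_trans leZr.
rewrite dvdn_leq // sub_in_partn // => q _; rewrite !inE => /eqP->.
exact: neq_pr.
Qed.

(** * Sylow orders and large primes *)

Lemma Sylow_card_le (gT : finGroupType) (G P : {group gT}) (p : nat) m :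
    ~~ abelian G -> cent_index_le G m -> prime p -> p.-Sylow(G) P ->
  #|P| <= m * (p * (32 * m ^ 11)).
Proof.
move=> nabG leG pr_p sylP; have m_gt0 := cent_index_gt0 nabG leG.
have sPG := pHall_sub sylP; have pP := pHall_pgroup sylP.
have leZ := center_card_le nabG leG.
have [abP | nabP] := boolP (abelian P); last first.
  apply: leq_trans (pgroup_card_le pP nabP (cent_index_leS sPG leG)) _.
  rewrite mulnA; apply: leq_trans (leq_pmull _ _); rewrite ?muln_gt0 ?m_gt0 ?prime_gt0 //.
  by rewrite leq_mul2l leq_pexp2l.
(* A central [P] is bounded by the centre; otherwise the abelian [P] lies in the centralizer of a
   noncentral p-element, at the cost of a factor [p]. *)
have [sPZ | /subsetPn[g gP gZ]] := boolP (P \subset 'Z(G)).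
  apply: leq_trans (subset_leq_card sPZ) (leq_trans leZ _).
  by rewrite mulnA leq_pmull // muln_gt0 m_gt0 prime_gt0.
have gG := subsetP sPG g gP.
have gGZ : g \in G :\: 'Z(G) by rewrite inE gZ.
have sPC : P \subset 'C_G[g] by rewrite subsetI sPG sub_cent1 (subsetP abP).
apply: leq_trans (subset_leq_card sPC) _.
apply: leq_trans (card_cent1_le leG pr_p (mem_p_elt pP gP) gGZ) _.
by rewrite !leq_mul2l leZ !orbT.
Qed.

Lemma large_prime_pi_star (gT : finGroupType) (G : {group gT}) m (p : nat) :
    ~~ abelian G -> cent_index_le G m -> p \in \pi(G) -> 32 * m ^ 11 < p ->
  p \in pi_star G.
Proof.
move=> nabG leG piGp lt_p; have m_gt0 := cent_index_gt0 nabG leG.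
(* Used twice: it gives [m < p], hence [#|P| < p ^ 2], and it yields the final contradiction. *)
have lt_m2p : m * m < p.
  apply: (leq_ltn_trans _ lt_p).
  by rewrite mulnn (leq_trans (leq_pexp2l m_gt0 (isT : 2 <= 11))) ?leq_pmull.
have [P sylP] := Sylow_exists p G.
have pr_p : prime p by move: piGp; rewrite mem_primes => /andP[].
have sPG := pHall_sub sylP; have pP := pHall_pgroup sylP.
have leZ := center_card_le nabG leG.
have p_dv_P : p %| #|P|.
  by rewrite (card_Hall sylP) -{1}(expn1 p) p_part dvdn_exp2l // logn_gt0.
have [g gP og] := Cauchy pr_p p_dv_P; have gG := subsetP sPG g gP.
have pg : p.-elt g := mem_p_elt pP gP.
have gGZ : g \in G :\: 'Z(G).
  rewrite inE gG andbT; apply: contraL lt_p => gZ; rewrite -leqNgt.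
  by apply: leq_trans leZ; rewrite -og subset_leq_card ?cycle_subG.
have abP : abelian P.
  apply: contraLR lt_p => nabP; rewrite -leqNgt.
  apply: leq_trans (dvdn_leq (cardG_gt0 P) p_dv_P) _.
  apply: leq_trans (pgroup_card_le pP nabP (cent_index_leS sPG leG)) _.
  by rewrite leq_mul2l leq_pexp2l.
have sPC : P \subset 'C_G[g] by rewrite subsetI sPG sub_cent1 (subsetP abP).
have leC : #|'C_G[g]| <= m * p by rewrite -og leG.
have oP : #|P| = p.
  have [k ok] := p_natP pP.
  have : (p ^ k < p ^ 2)%N.
    rewrite -ok (leq_ltn_trans (leq_trans (subset_leq_card sPC) leC)) //.
    by rewrite expnS expn1 ltn_pmul2r ?prime_gt0 // (leq_ltn_trans _ lt_m2p) ?leq_pmull.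
  rewrite ltn_exp2l ?prime_gt1 // => lt_k2.
  move: p_dv_P lt_k2; rewrite ok; case: k {ok} => [|[|k]] //.
  by rewrite dvdn1 => /eqP p1; rewrite p1 in pr_p.
have defP : P :=: <[g]>.
  by apply/eqP; rewrite eq_sym eqEcard cycle_subG gP oP -og /=.
rewrite inE piGp; apply/existsP; exists P; rewrite inE sylP oP eqxx /=.
rewrite eqEsubset mulG_subG subsetI sPG (abP : P \subset 'C(P)) setIS ?centS // !andbT.
apply/subsetP=> x; rewrite {1}defP cent_cycle => xC; have /setIP[xG cgx] := xC.
(* The p-part of [x] falls into [P], the normal Sylow subgroup of ['C_G[g]]; the p'-part [y] must be
   shown central. *)
have sCx pi : x.`_pi \in 'C_G[g] by rewrite groupX.
rewrite -(consttC p x) mem_mulg //.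
  have sylPC : p.-Sylow('C_G[g]) P by apply: pHall_subl sylP; rewrite ?subsetIl.
  rewrite (mem_normal_Hall sylPC) ?p_elt_constt //.
  by rewrite /normal sPC cents_norm // defP cent_cycle subsetIr.
apply: contraLR lt_m2p => yZ; rewrite -leqNgt.
set y := x.`_p^' in yZ *; have /setIP[yG cgy] := sCx p^'.
have yGZ : y \in G :\: 'Z(G) by rewrite inE yZ.
(* The coprime numbers [#[y]] and [p] both divide [#|'C_G[g]|], which is at most [m * p]. *)
have le_y : #[y] <= m.
  rewrite -(leq_pmul2r (prime_gt0 pr_p)); apply: leq_trans leC.
  rewrite dvdn_leq // Gauss_dvd.
    rewrite order_dvdG ?sCx // -og order_dvdG //.
    by rewrite (subsetP sPC).
  by rewrite coprime_sym; apply: pnat_coprime (pnat_id pr_p) (p_elt_constt _ _).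
have sPCy : P \subset 'C_G[y].
  rewrite subsetI sPG defP cycle_subG /=.
  by apply/cent1P; apply: commute_sym; apply/cent1P.
have leCy := leG y yGZ.
rewrite -{1}oP; apply: leq_trans (subset_leq_card sPCy) (leq_trans leCy _).
by rewrite leq_mul2l le_y orbT.
Qed.

(** * Assembling the bound prime by prime *)

Lemma partn_pi_star (gT : finGroupType) (G : {group gT}) (p : nat) :
  p \in pi_star G -> (#|G|`_p)%N = p.
Proof.
rewrite inE => /andP[_ /existsP[P /and3P[sylP /eqP oP _]]].
by rewrite inE in sylP; rewrite -(card_Hall sylP).
Qed.

Local Close Scope group_scope.

Theorem theoremB :
  exists f0 : nat -> nat,
    (forall m : nat, 0 < m -> 0 < f0 m) /\
    forall (gT : finGroupType) (G : {group gT}),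
      ~~ abelian G ->
      #|G| <= (\prod_(p <- primes #|G| | p \in pi_star G) p) * f0 (mci G).
Proof.
(* [B m] bounds the centre and the prime divisors outside [pi_star G]; [M m] is the Sylow bound with
   [p] replaced by [B m]. *)
pose B m := 32 * m ^ 11; pose M m := m * (B m * B m).
have M_gt0 m : 0 < m -> 0 < M m.
  move=> m_gt0; have B_gt0 : 0 < B m by rewrite muln_gt0 expn_gt0 m_gt0.
  by rewrite /M !(muln_gt0 m, muln_gt0 (B m)) m_gt0 B_gt0.
(* The exponent counts the integers from 0 to [B m], among which the remaining primes lie. *)
exists (fun m => M m ^ (B m).+1); split=> [m m_gt0 | gT G nabG].
  by rewrite expn_gt0 M_gt0.
have leG := mci_cent_index_le (G := G); set m := mci G in leG *.
have m_gt0 := cent_index_gt0 nabG leG.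
(* [#|G|] is the product of its p-parts, and for [p] in [pi_star G] the p-part is [p] itself. *)
rewrite {1}[#|G|]prod_prime_decomp // prime_decompE big_map /=.
rewrite (bigID (mem (pi_star G))) /=; apply: leq_mul.
  rewrite leq_eqVlt; apply/orP; left; apply/eqP; apply: eq_bigr => p pi_p.
  by rewrite -p_part partn_pi_star.
rewrite big_seq_cond.
apply: (@leq_trans (\prod_(p <- primes #|G| | p \notin pi_star G) M m)).
  rewrite [leqRHS]big_seq_cond; apply: leq_prod => p /andP[piGp npi].
  have [P sylP] := Sylow_exists p G.
  have pr_p : prime p by move: piGp; rewrite mem_primes => /andP[].
  rewrite -p_part -(card_Hall sylP).
  apply: leq_trans (Sylow_card_le nabG leG pr_p sylP) _.
  rewrite !leq_mul2l !leq_mul2r [p <= _]leqNgt.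
  by rewrite (contra (large_prime_pi_star nabG leG piGp)) ?orbT.
rewrite big_const_seq iter_muln_1 -size_filter leq_pexp2l ?M_gt0 //.
rewrite -(size_iota 0 (B m).+1); apply: uniq_leq_size.
  exact: filter_uniq (primes_uniq _).
move=> p; rewrite mem_filter mem_iota add0n ltnS => /andP[npi piGp] /=.
by rewrite leqNgt (contra (large_prime_pi_star nabG leG piGp)).
Qed.
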